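(* Let $k$ be an algebraic closure of $\mathbb{F}_q$ and let $F_1,\dots,F_r$ be any homogeneous polynomials in $k[x_0,\dots,x_m]$. Let $X=V(F_1,\dots,F_r)$ be the corresponding projective variety in $\mathbb{P}^m(k)$. Then $$|X(\mathbb{F}_q)|\le \left|\overline{\Delta}_e(F_1,\dots,F_r)\right|\quad\text{for all } e\gg 0.$$
   Context: $q$ is a prime power, $\mathbb{F}_q$ is the finite field with $q$ elements, and $m$ is a positive integer. $V(F_1,\dots,F_r)$ is the set of common zeros of $F_1,\dots,F_r$ in $\mathbb{P}^m(k)$, and $X(\mathbb{F}_q)=X\cap\mathbb{P}^m(\mathbb{F}_q)$. Projective reduction: let $\mathbb{M}$ be the set of all monomials in $x_0,\dots,x_m$. Put $\overline{1}:=1$. If $\mu\in\mathbb{M}$, $\mu\neq 1$, write uniquely $\mu=x_0^{a_0}\cdots x_\ell^{a_\ell}$ with $0\le \ell\le m$, $a_i\ge 0$ and $a_\ell>0$. For $0\le i\le \ell-1$ let $\overline{a}_i=a_i$ if $0\le a_i\le q-1$, and if $a_i\ge q$ let $\overline{a}_i$ be the unique integer with $1\le\overline{a}_i\le q-1$ and $\overline{a}_i\equiv a_i\pmod{q-1}$. Define $$\overline{\mu}:=x_0^{\overline{a}_0}\cdots x_{\ell-1}^{\overline{a}_{\ell-1}}x_\ell^{a_\ell+\sum_{i=0}^{\ell-1}(a_i-\overline{a}_i)}.$$ Extend $\mu\mapsto\overline{\mu}$ to a $k$-linear map $f\mapsto\overline{f}$ on $k[x_0,\dots,x_m]$; $\overline{f}$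 is the projective reduction of $f$. Let $\overline{\mathbb{M}}_e$ be the set of monomials $\mu$ of degree $e$ with $\overline{\mu}=\mu$. A monomial order $\preccurlyeq$ on $\mathbb{M}$ is fixed, with $x_0\succ x_1\succ\cdots\succ x_m$; $\mathrm{lm}(F)$ denotes the leading monomial of a nonzero polynomial $F$. For $S\subseteq k[x_0,\dots,x_m]$ and $e\in\mathbb{N}=\{0,1,2,\dots\}$, the projective $\mathbb{F}_q$-footprint of $S$ in degree $e$ is $$\overline{\Delta}_e(S):=\{\mu\in\overline{\mathbb{M}}_e : \mathrm{lm}(\overline{F})\nmid\mu\text{ for all homogeneous }F\in S\text{ with }\overline{F}\ne 0\},$$ and $\overline{\Delta}_e(F_1,\dots,F_r):=\overline{\Delta}_e(\{F_1,\dots,F_r\})$. ''For all $e\gg 0$'' means: there is $e_0\in\mathbb{N}$ such that the assertion holds for all integers $e\ge e_0$. *)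

(* Defs.v *)
From HB Require Import structures.
From mathcomp Require Import all_boot all_order all_algebra.
From mathcomp Require Import finmap ssrcomplements mpoly.

Set Implicit Arguments.
Unset Strict Implicit.
Unset Printing Implicit Defensive.

Import GRing.Theory.

Local Open Scope ring_scope.

(* Monomial orders on 'X_{1..n}, where 0%MM is the monomial 1 and monomials
   multiply with (_ + _)%MM. *)
Record monomial_order n (le : rel 'X_{1..n}) : Prop := MonomialOrder {
  mo_anti : antisymmetric le;
  mo_trans : transitive le;
  mo_total : total le;
  mo_min1 : forall mu, le 0%MM mu;
  mo_mul : forall mu nu rho, le mu nu -> le (mu + rho)%MM (nu + rho)%MM }.

Definition mo_lt n (le : rel 'X_{1..n}) : rel 'X_{1..n} :=
  fun mu nu => (mu != nu) && le mu nu.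

Definition mo_max n (le : rel 'X_{1..n}) (mu nu : 'X_{1..n}) :=
  if le mu nu then nu else mu.

(* The default value 0%MM only matters for f = 0, see lm_supp and lm_ge. *)
Definition lm n (k : nzRingType) (le : rel 'X_{1..n}) (f : {mpoly k[n]}) :
    'X_{1..n} :=
  \big[mo_max le/0%MM]_(mu <- msupp f) mu.

Section LeadingMonomial.
Variables (n : nat) (k : nzRingType) (le : rel 'X_{1..n}).
Hypothesis mo : monomial_order le.

Lemma lm_supp (f : {mpoly k[n]}) : f != 0 -> lm le f \in msupp f.
Proof.
rewrite -msupp_eq0 /lm; elim: (msupp f) => // mu [|nu s] IHs _.
  rewrite big_cons big_nil /mo_max inE; case: ifP => // le_mu1.
  by apply/eqP/(mo_anti mo); rewrite le_mu1 (mo_min1 mo).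
rewrite big_cons {1}/mo_max; case: ifP => _; last by rewrite inE eqxx.
by rewrite inE IHs ?orbT.
Qed.

Lemma lm_ge (f : {mpoly k[n]}) mu : mu \in msupp f -> le mu (lm le f).
Proof.
have lexx nu : le nu nu by have := mo_total mo nu nu; rewrite orbb.
rewrite /lm; elim: (msupp f) => // nu s IHs; rewrite inE big_cons {1}/mo_max.
case/orP=> [/eqP->|/IHs le_mu]; first by case: ifP.
case: ifPn => // nle; apply: (mo_trans mo) le_mu _.
by have := mo_total mo nu (\big[mo_max le/0%MM]_(j <- s) j); rewrite (negPf nle).
Qed.

End LeadingMonomial.

(* For a >= q, the representative of a modulo q - 1 in {1, ..., q - 1}. *)
Definition expo_red (q a : nat) : nat :=
  if (a < q)%N then a else ((a - 1) %% (q - 1)).+1%N.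

Lemma expo_redP (q a : nat) : (1 < q <= a)%N ->
  [/\ (1 <= expo_red q a)%N, (expo_red q a <= q - 1)%N
    & expo_red q a = a %[mod q - 1]].
Proof.
case/andP=> q1 qa; have q0 : (0 < q - 1)%N by rewrite subn_gt0.
rewrite /expo_red (leq_gtF qa); split=> //; first by rewrite ltn_pmod.
have a0 : (0 < a)%N by apply: leq_trans qa; apply: ltnW.
by rewrite -addn1 modnDml subnK.
Qed.

Lemma expo_red_le (q a : nat) : (0 < q)%N -> (expo_red q a <= a)%N.
Proof.
move=> q0; rewrite /expo_red; case: ltnP => // qa.
by rewrite -(prednK (leq_trans q0 qa)) subn1 ltnS leq_mod.
Qed.

Definition last_var n (mu : 'X_{1..n}) : nat := \max_(i < n | mu i != 0%N) i.

(* The monomial 1 (where last_var is 0) is sent to itself.  The natural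
   subtractions are exact by expo_red_le. *)
Definition mred (q n : nat) (mu : 'X_{1..n}) : 'X_{1..n} :=
  let l := last_var mu in
  [multinom
     (if (i < l)%N then expo_red q (mu i)
      else if i == l :> nat
           then mu i + \sum_(j < n | (j < l)%N) (mu j - expo_red q (mu j))
           else 0)%N | i < n].

Definition proj_red (q n : nat) (k : nzRingType) (f : {mpoly k[n]}) :
    {mpoly k[n]} :=
  \sum_(mu <- msupp f) f@_mu *: 'X_[mred q mu].

Lemma proj_redX (q n : nat) (k : nzRingType) (mu : 'X_{1..n}) :
  proj_red q ('X_[mu] : {mpoly k[n]}) = 'X_[mred q mu].
Proof. by rewrite /proj_red msuppX big_seq1 mcoeffX eqxx scale1r. Qed.

Lemma proj_redwE (q n : nat) (k : nzRingType) (f : {mpoly k[n]}) (w : nat) :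
  (msize f <= w)%N ->
  proj_red q f = \sum_(mu : 'X_{1..n < w}) f@_mu *: 'X_[mred q mu].
Proof.
move=> f_w; pose I : subFinType _ := 'X_{1..n < w}.
rewrite /proj_red (big_mksub I) //=; first last.
- by move=> mu /msize_mdeg_lt /leq_trans; apply.
- by rewrite msupp_uniq.
by rewrite big_rmcond // => mu /memN_msupp_eq0 ->; rewrite scale0r.
Qed.

Lemma proj_red_linear (q n : nat) (k : nzRingType) :
  linear (@proj_red q n k).
Proof.
move=> c f g; pose w := maxn (msize (c *: f + g)) (maxn (msize f) (msize g)).
rewrite !(@proj_redwE _ _ _ _ w) ?leq_max ?leqnn ?orbT //.
rewrite scaler_sumr -big_split; apply: eq_bigr => mu _ /=.
by rewrite linearP /= scalerDl scalerA.
Qed.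

(* The footprint of a finite set S, listed by a sequence; monomials of degree e
   are taken in the finite type of monomials of degree < e.+1. *)
Definition footprint (q n : nat) (k : nzRingType) (le : rel 'X_{1..n})
    (S : seq {mpoly k[n]}) (e : nat) : {set 'X_{1..n < e.+1}} :=
  [set mu : 'X_{1..n < e.+1} |
    [&& mdeg mu == e, mred q mu == mu &
        all (fun f => (f \is homog mdeg) && (proj_red q f != 0) ==>
                        ~~ (lm le (proj_red q f) <= mu)%MM) S]].

(* The points of P^m(K) are the lines of K^(m+1) through the origin. *)
Definition projective_space (K : fieldType) (m : nat) :=
  {L : {vspace 'rV[K]_m.+1} | \dim L == 1%N}.

Definition proj_pt (K : fieldType) (m : nat)
    (v : {v : 'rV[K]_m.+1 | v != 0}) : projective_space K m :=
  exist _ <[val v]>%VS (introT eqP (etrans (dim_vline (val v))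
                                           (congr1 nat_of_bool (valP v)))).

Lemma map_row_neq0 (F k : fieldType) (iota : {rmorphism F -> k}) (m : nat)
  (v : {v : 'rV[F]_m.+1 | v != 0}) : map_mx iota (val v) != 0.
Proof. by rewrite map_mx_eq0 (valP v). Qed.

(* P^m(F) as a subset of P^m(k), for a finite subfield F of k. *)
Definition rational_points (F : finFieldType) (k : fieldType)
    (iota : {rmorphism F -> k}) (m : nat) : {fset projective_space k m} :=
  [fset proj_pt (exist _ (map_mx iota (val v)) (map_row_neq0 iota v))
     | v in {: {v : 'rV[F]_m.+1 | v != 0}}]%fset.

(* The common zeros in P^m(k) of the homogeneous polynomials in S, tested on one
   representative (vpick) of each point; see proj_zeroP. *)
Definition proj_zeros (k : fieldType) (m : nat) (S : seq {mpoly k[m.+1]}) :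
    pred (projective_space k m) :=
  fun P => all (fun f => f.@[fun i => vpick (val P) 0 i] == 0) S.

Lemma proj_zeroP (k : fieldType) (m d : nat) (f : {mpoly k[m.+1]})
    (P : projective_space k m) (v : 'rV[k]_m.+1) :
    f \is d.-homog -> v \in val P -> v != 0 ->
  (f.@[fun i => vpick (val P) 0 i] == 0) = (f.@[fun i => v 0 i] == 0).
Proof.
move=> /dhomogP hf vP v0.
have defP : (val P = <[v]>)%VS.
  apply/esym/eqP; rewrite eqEdim -memvE vP dim_vline v0.
  by rewrite (eqP (valP P)).
have /vlineP[c defw] : vpick (val P) \in <[v]>%VS by rewrite -defP memv_pick.
have c0 : c != 0.
  apply: contraNneq v0 => c0.
  have /eqP : vpick (val P) = 0 by rewrite defw c0 scale0r.
  by rewrite vpick0 defP -memv0 => /eqP <-; rewrite memv_line.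
suff -> : f.@[fun i => vpick (val P) 0 i] = c ^+ d * f.@[fun i => v 0 i].
  by rewrite mulf_eq0 expf_eq0 (negPf c0) andbF.
rewrite !mevalE mulr_sumr !big_seq; apply: eq_bigr => mu mu_f.
rewrite mulrCA -(hf _ mu_f) /= mdegE -prodrXr -big_split /=; congr (_ * _).
by apply: eq_bigr => i _; rewrite defw mxE exprMn.
Qed.

Definition zeros_rat (F : finFieldType) (k : fieldType)
    (iota : {rmorphism F -> k}) (m : nat) (S : seq {mpoly k[m.+1]}) :
    {fset projective_space k m} :=
  [fset P in rational_points iota m | proj_zeros S P]%fset.

(* Main.v *)
(* For e > m (q - 1) the indicators of the rational points are values of forms of
   degree e, so a linear form L(f) = \sum_P w_P f(P) on the rational points of X
   vanishing on all forms of degree e is zero.  On the other hand L vanishes on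
   all forms of degree e as soon as it vanishes on the footprint: projective
   reduction preserves degrees and values at rational points and, as
   x_0 > ... > x_m, never increases a monomial, so one can induct along the
   monomial order.  Hence the matrix of values of the footprint monomials at the
   points of X(F_q) has independent rows. *)

Require Import Defs.
From HB Require Import structures.
From mathcomp Require Import all_boot all_order all_algebra.
From mathcomp Require Import finmap mpoly.
From mathcomp Require finfield.

Set Implicit Arguments.
Unset Strict Implicit.
Unset Printing Implicit Defensive.

Import GRing.Theory.

Local Open Scope ring_scope.

(** * Exponents modulo q - 1 *)

Lemma expr_addn_mul (R : nzRingType) (x : R) (q a t : nat) :
  (0 < q)%N -> (0 < a)%N -> x ^+ q = x -> x ^+ (a + t * (q - 1)) = x ^+ a.
Proof.
case: q => // q _; rewrite subn1 /= => a0 xq.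
elim: t => [|t IHt]; first by rewrite addn0.
rewrite -[RHS]IHt mulSn addnCA -(prednK a0) addSn.
by rewrite addnS -addSn exprD xq -exprS.
Qed.

Lemma dvdn_expo_red (q a : nat) : (q - 1 %| a - expo_red q a)%N.
Proof.
rewrite /expo_red; case: ltnP => [_|qa]; first by rewrite subnn dvdn0.
rewrite -[(_ %% _).+1]add1n subnDA [X in (_ %| X - _)%N](divn_eq _ (q - 1)) addnK.
exact: dvdn_mull.
Qed.

Lemma expr_expo_red (R : nzRingType) (x : R) (q a : nat) :
  (0 < q)%N -> x ^+ q = x -> x ^+ expo_red q a = x ^+ a.
Proof.
move=> q0 xq; have /dvdnP[t def_t] := dvdn_expo_red q a.
have [aq|qa] := ltnP a q; first by rewrite /expo_red aq.
rewrite -[in RHS](subnKC (expo_red_le a q0)) def_t expr_addn_mul //.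
(* For a >= q the reduced exponent is a successor; being positive, it keeps the identity true at x =
   0. *)
by rewrite /expo_red (leq_gtF qa).
Qed.

(** * Projective reduction: degree, monomial order and values *)

Section Reduction.
Variables (q n : nat).
Hypothesis q_gt0 : (0 < q)%N.
Implicit Types mu nu : 'X_{1..n}.

Lemma last_var_lt mu (i : 'I_n) : (last_var mu < i)%N -> mu i = 0%N.
Proof.
rewrite ltnNge => /negP hi; apply/eqP; apply: contra_notT hi => mui.
exact: (leq_bigmax_cond (F := @nat_of_ord n)).
Qed.

(** [last_var] takes the default value 0 on the monomial 1; positivity excludes this empty maximum,
    so the maximum is attained at a variable that occurs. *)
Lemma last_var_neq0 mu (i : 'I_n) :
  i = last_var mu :> nat -> (0 < last_var mu)%N -> mu i != 0%N.
Proof.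
move=> def_i l0; have [A0|] := posnP #|[pred i | mu i != 0%N]|.
  move: l0; rewrite /last_var big_pred0 // => j.
  by apply/negbTE; have /negbT := card0_eq A0 j.
case/(eq_bigmax_cond (@nat_of_ord n)) => j; rewrite !inE => muj def_j.
by rewrite (_ : i = j) //; apply: ord_inj; rewrite def_i -def_j.
Qed.

(* Reduction moves the surplus exponents from variables before x_l to x_l. *)
Lemma mred_transfer mu : exists nu (c : 'I_n -> nat) (l : 'I_n -> 'I_n),
  [/\ mu = (nu + \sum_i U_(i) *+ c i)%MM,
      mred q mu = (nu + \sum_i U_(l i) *+ c i)%MM
    & forall i, c i != 0%N -> (i < l i)%N].
Proof.
have [n0|n_gt0] := posnP n.
  have no_var (i : 'I_n) : False by have := ltn_ord i; rewrite [X in (_ < X)%N]n0.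
  by exists mu, (fun=> 0%N), id; split=> //; apply/mnmP=> i; case: (no_var i).
have l_lt : (last_var mu < n)%N.
  have : (last_var mu <= n.-1)%N.
    by apply/bigmax_leqP=> i _; rewrite -ltnS prednK.
  by rewrite -ltnS prednK.
pose l := Ordinal l_lt.
pose c (i : 'I_n) := if (i < l)%N then (mu i - expo_red q (mu i))%N else 0%N.
have sumU (i : 'I_n) : (\sum_j U_(j) *+ c j)%MM i = c i.
  rewrite mnm_sumE (bigD1 i) //= mulmnE mnm1E eqxx mul1n big1 ?addn0 // => j.
  by rewrite mulmnE mnm1E => /negbTE->.
exists [multinom if (i < l)%N then expo_red q (mu i) else mu i | i < n].
exists c, (fun=> l); split; last by move=> i; rewrite /c; case: ifP.
  apply/mnmP=> i; rewrite mnmDE mnmE sumU /c.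
  case: ifP => _; last by rewrite addn0.
  by rewrite subnKC ?expo_red_le.
apply/mnmP=> i; rewrite mnmDE !mnmE mnm_sumE.
under eq_bigr do rewrite mulmnE mnm1E -val_eqE /= eq_sym.
case: ltngtP => [il|il|il]; rewrite /= ?mul1n.
- by rewrite big1 ?addn0 // => j _; rewrite mul0n.
- rewrite big1 => [|j _]; last by rewrite mul0n.
  by rewrite addn0 last_var_lt.
by rewrite big_mkcond; under [in RHS]eq_bigr do rewrite mul1n.
Qed.

Lemma mdeg_mred mu : mdeg (mred q mu) = mdeg mu.
Proof.
have [nu [c [l [-> -> _]]]] := mred_transfer mu.
rewrite !mdegD !mdeg_sum; congr addn; apply: eq_bigr => i _.
by rewrite !mdegMn !mdeg1.
Qed.

Section MonomialOrder.
Variable le : rel 'X_{1..n}.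
Hypothesis mo : monomial_order le.

Lemma mo_refl mu : le mu mu.
Proof. by have := mo_total mo mu mu; rewrite orbb. Qed.

Lemma mo_add mu nu rho sigma :
  le mu nu -> le rho sigma -> le (mu + rho)%MM (nu + sigma)%MM.
Proof.
move=> le1 le2; apply: (mo_trans mo) (mo_mul mo rho le1) _.
by rewrite ![(nu + _)%MM]addmC mo_mul.
Qed.

Lemma mo_muln mu nu t : le mu nu -> le (mu *+ t)%MM (nu *+ t)%MM.
Proof.
move=> le_mn; elim: t => [|t IHt]; first by rewrite !mulm0n mo_refl.
by rewrite !mulmS mo_add.
Qed.

Lemma mo_lt_trans mu nu rho :
  mo_lt le mu nu -> mo_lt le nu rho -> mo_lt le mu rho.
Proof.
case/andP=> neq_mn le_mn /andP[_ le_nr]; rewrite /mo_lt (mo_trans mo le_mn le_nr).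
rewrite andbT; apply: contraNneq neq_mn => def_mu; apply/eqP/(mo_anti mo).
by rewrite le_mn def_mu.
Qed.

Lemma mo_ltD2r mu nu rho :
  mo_lt le mu nu -> mo_lt le (mu + rho)%MM (nu + rho)%MM.
Proof.
case/andP=> neq_mn le_mn; rewrite /mo_lt (mo_mul mo) // andbT.
by apply: contraNneq neq_mn => /(can_inj (addmK rho)) ->.
Qed.

(** By [mred_transfer], reduction only trades powers of a variable for equal powers of a later,
    hence smaller, one. *)
Lemma mred_le mu :
  (forall i j : 'I_n, (i < j)%N -> mo_lt le U_(j)%MM U_(i)%MM) ->
  le (mred q mu) mu.
Proof.
move=> hvar; have [nu [c [l [-> -> hl]]]] := mred_transfer mu.
apply: mo_add (mo_refl _) _.
elim/big_ind2: _ => [|? ? ? ?|i _]; [exact: mo_refl | exact: mo_add |].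
have [->|/hl/hvar/andP[_ le_i]] := eqVneq (c i) 0%N; last exact: mo_muln.
by rewrite !mulm0n mo_refl.
Qed.

(** Only finitely many monomials have degree at most d, so one can induct on the number of those
    lying below mu. *)
Lemma mo_deg_ind (d : nat) (P : 'X_{1..n} -> Prop) :
  (forall mu, mdeg mu = d ->
     (forall nu, mdeg nu = d -> mo_lt le nu mu -> P nu) -> P mu) ->
  forall mu, mdeg mu = d -> P mu.
Proof.
move=> IH mu; pose B mu := [set nu : 'X_{1..n < d.+1} | mo_lt le nu mu].
have [s] := ubnP #|B mu|; elim: s mu => // s IHs mu lt_s mu_d.
apply: IH => // nu nu_d lt_nm; apply: IHs => //.
rewrite -ltnS; apply: leq_trans lt_s; rewrite ltnS.
have nu_lt : (mdeg nu < d.+1)%N by rewrite nu_d.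
apply/proper_card/properP; split.
  by apply/subsetP=> rho; rewrite !inE => /mo_lt_trans; apply.
by exists (BMultinom nu_lt); rewrite inE //= /mo_lt eqxx.
Qed.

End MonomialOrder.

Section Evaluation.
Variable k : comNzRingType.
Implicit Types (v : 'I_n -> k) (f : {mpoly k[n]}).

Lemma meval_mred v mu : (forall i, v i ^+ q = v i) ->
  ('X_[mred q mu] : {mpoly k[n]}).@[v] = ('X_[mu]).@[v].
Proof.
move=> vq; rewrite !mevalX; apply: eq_bigr => i _; rewrite mnmE.
case: ltngtP => [_|li|def_i]; first by rewrite expr_expo_red.
  by rewrite last_var_lt.
(* If the last variable is x_0, or mu = 1, nothing is moved. Otherwise x_l receives a multiple of q
   - 1 on top of a positive exponent. *)
have [l0|l0] := posnP (last_var mu).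
  by rewrite big_pred0 ?addn0 // => j; rewrite l0.
have /dvdnP[t ->] : (q - 1 %| \sum_(j < n | (j < last_var mu)%N)
    (mu j - expo_red q (mu j)))%N by apply: dvdn_sum => j _; apply: dvdn_expo_red.
by rewrite expr_addn_mul // lt0n last_var_neq0.
Qed.

Lemma meval_proj_red v f : (forall i, v i ^+ q = v i) ->
  (proj_red q f).@[v] = f.@[v].
Proof.
move=> vq; rewrite {2}[f]mpolyE /proj_red !rmorph_sum; apply: eq_bigr => mu _.
by rewrite /= !mevalZ meval_mred.
Qed.

Lemma dhomog_proj_red d f :
  f \is d.-homog for mdeg -> proj_red q f \is d.-homog for mdeg.
Proof.
move=> /dhomogP hf; rewrite /proj_red big_seq; apply: rpred_sum => mu /hf mu_d.
by apply: rpredZ; rewrite dhomogX; apply/eqP; rewrite -mu_d; apply: mdeg_mred.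
Qed.

End Evaluation.
End Reduction.

(** * Linear forms in the values that vanish on the footprint *)

Section Functional.
Variables (q n : nat) (k : fieldType) (le : rel 'X_{1..n}).
Hypothesis q_gt0 : (0 < q)%N.
Hypothesis mo : monomial_order le.
Hypothesis hvar : forall i j : 'I_n, (i < j)%N -> mo_lt le U_(j)%MM U_(i)%MM.

(* A monomial mu of degree e outside the footprint is either not reduced, hence
   agrees on rational points with a smaller monomial, or is the leading monomial
   of a multiple of some reduction of an element of S; that multiple vanishes at
   all the points, so L(mu) is a combination of values of L at smaller monomials. *)
Lemma footprint_functional (I : finType) (v : I -> 'I_n -> k) (w : I -> k)
    (S : seq {mpoly k[n]}) (e : nat) :
  (forall i j, v i j ^+ q = v i j) ->
  (forall i f, f \in S -> f.@[v i] = 0) ->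
  (forall mu, mu \in footprint q le S e ->
     \sum_i w i * ('X_[val mu] : {mpoly k[n]}).@[v i] = 0) ->
  forall f : {mpoly k[n]}, f \is e.-homog for mdeg ->
    \sum_i w i * f.@[v i] = 0.
Proof.
move=> vq vS; pose L (f : {mpoly k[n]}) := \sum_i w i * f.@[v i].
rewrite -/(L _) => L_foot.
(* Used twice: with rho = 1 to reduce to monomials, and with rho = mu / lm(g) to exploit a leading
   monomial. *)
have LE (f : {mpoly k[n]}) rho :
    L (f * 'X_[rho]) = \sum_(nu <- msupp f) f@_nu * L 'X_[nu + rho].
  rewrite /L {1}[f]mpolyE mulr_suml.
  under eq_bigr do rewrite rmorph_sum mulr_sumr.
  rewrite exchange_big; apply: eq_bigr => nu _; rewrite mulr_sumr.
  by apply: eq_bigr => i _; rewrite -scalerAl -mpolyXD /= mevalZ mulrCA.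
suff LX mu : mdeg mu = e -> L 'X_[mu] = 0.
  move=> f /dhomogP hf; rewrite -[f]mulr1 -mpolyX0 -/(L _) LE big_seq big1 //.
  move=> nu /hf nu_e.
  by rewrite addm0 LX ?mulr0.
move: mu; apply: (mo_deg_ind mo) => mu mu_e IH.
have [mu_red|mu_nred] := eqVneq (mred q mu) mu; last first.
  have <- : L 'X_[mred q mu] = L 'X_[mu].
    by apply: eq_bigr => i _; rewrite meval_mred.
  by apply: IH; rewrite ?mdeg_mred // /mo_lt mu_nred mred_le.
have mu_lt : (mdeg mu < e.+1)%N by rewrite mu_e.
have [/L_foot //|] := boolP (BMultinom mu_lt \in footprint q le S e).
rewrite inE /= mu_e mu_red !eqxx /= => /allPn[f fS].
rewrite negb_imply negbK => /andP[/andP[/homogP[d /(dhomog_proj_red q_gt0)]]].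
set g := proj_red q f => /dhomogP hg g0 lm_mu.
have lm_g := lm_supp mo g0; set rho := (mu - lm le g)%MM.
have def_mu : (lm le g + rho)%MM = mu by rewrite addmC submK.
have : L (g * 'X_[rho]) = 0.
  rewrite /L big1 // => i _.
  by rewrite rmorphM /= meval_proj_red // vS // mul0r mulr0.
(* The term at mu has the nonzero leading coefficient of g, so it remains to kill the other terms:
   they have degree e and lie below mu. *)
rewrite LE (bigD1_seq (lm le g)) ?msupp_uniq //= def_mu big_seq_cond big1.
  by move/eqP; rewrite addr0 mulf_eq0 mcoeff_eq0 lm_g => /eqP.
move=> nu /andP[nu_g nu_lm]; rewrite IH ?mulr0 //.
  by rewrite mdegD (hg _ nu_g) -(hg _ lm_g) /= -mdegD def_mu.
by rewrite -def_mu mo_ltD2r // /mo_lt nu_lm lm_ge.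
Qed.

End Functional.

(** The hypothesis makes the rows of the matrix A independent, so its rank is the number of rows,
    bounded by the number of columns. *)
Lemma card_le_separating (K : fieldType) (I J : finType) (A : I -> J -> K) :
  (forall w : I -> K, (forall j, \sum_i w i * A i j = 0) -> forall i, w i = 0) ->
  (#|I| <= #|J|)%N.
Proof.
move=> sepA; pose M := \matrix_(a, b) A (@enum_val I I a) (@enum_val J J b).
suff /eqP <- : row_free M by apply: rank_leq_col.
apply: inj_row_free => w wM; apply/rowP=> a; rewrite mxE -[a]enum_valK.
apply: (sepA (fun i => w 0 (enum_rank i))) => j.
have /rowP/(_ (enum_rank j)) := wM; rewrite !mxE => {2}<-.
rewrite (reindex (@enum_val I I)) /=; last first.
  by exists enum_rank => i _; rewrite ?enum_valK ?enum_rankK.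
by apply: eq_bigr => i _; rewrite enum_valK mxE enum_rankK.
Qed.

Lemma dhomog_prod_const (R : comNzRingType) (n d : nat) (I : finType) (P : pred I)
    (f : I -> {mpoly R[n]}) :
  (forall i, P i -> f i \is d.-homog for mdeg) ->
  \prod_(i | P i) f i \is (#|P| * d).-homog for mdeg.
Proof.
move=> hf; rewrite -sum_nat_const.
elim/big_rec2: _ => [|i e g Pi hg]; first exact: dhomog1.
by apply: dhomogM hg; apply: hf.
Qed.

(** * Forms of degree e separating rational points *)

Section Separation.
Variables (Fq : finFieldType) (k : fieldType) (iota : {rmorphism Fq -> k}).
Local Notation q := #|Fq|.

Lemma expf_card_pred (x : Fq) : x ^+ (q - 1) = (x != 0)%:R.
Proof.
have q_gt1 : (1 < q)%N by apply: card_finNzRing_gt1.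
have [->|x0] := eqVneq x 0; first by rewrite expr0n subn_eq0 leqNgt q_gt1.
apply: (mulfI x0); rewrite -exprS subn1 prednK ?mulr1 ?finfield.expf_card //.
exact: ltnW.
Qed.

(* The factor of index i is 1 or 0 on the rational points with u_j != 0,
   according to whether v_j u_i = v_i u_j, and the power of x_j kills the points
   with u_j = 0. *)
Lemma point_separator (m e : nat) (v : 'rV[Fq]_m.+1) :
  v != 0 -> (m * (q - 1) < e)%N ->
  exists h : {mpoly k[m.+1]},
  [/\ h \is e.-homog for mdeg,
      h.@[fun i => iota (v 0 i)] != 0
    & forall u : 'rV[Fq]_m.+1, h.@[fun i => iota (u 0 i)] != 0 ->
        exists2 c, c != 0 & u = c *: v].
Proof.
move=> /rV0Pn[j vj] he.
pose l i : {mpoly k[m.+1]} := iota (v 0 j) *: 'X_i - iota (v 0 i) *: 'X_j.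
(* The m factors have total degree m (q - 1); the power of ['X_j] completes it to e, with positive
   exponent by [he]. *)
pose h : {mpoly k[m.+1]} := 'X_j ^+ (e - m * (q - 1)) *
  \prod_(i | i != j) ('X_j ^+ (q - 1) - l i ^+ (q - 1)).
have hX i : ('X_i : {mpoly k[m.+1]}) \is 1.-homog for mdeg.
  by rewrite dhomogX /= mdeg1.
have hXn (p : {mpoly k[m.+1]}) t :
    p \is 1.-homog for mdeg -> p ^+ t \is t.-homog for mdeg.
  by move/(dhomogMn t); rewrite mul1n.
(* The values are images of elements of [Fq], where [expf_card_pred] turns the powers q - 1 into
   indicators. *)
have hE (u : 'rV[Fq]_m.+1) : h.@[fun i => iota (u 0 i)] =
    iota (u 0 j ^+ (e - m * (q - 1)) * \prod_(i | i != j)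
      (u 0 j ^+ (q - 1) - (v 0 j * u 0 i - v 0 i * u 0 j) ^+ (q - 1))).
  rewrite /h mevalM rmorph_prod [RHS]rmorphM rmorph_prod !rmorphXn /= mevalXU.
  congr (_ * _); apply: eq_bigr => i _.
  rewrite mevalB rmorphB !rmorphXn /= mevalXU.
  by rewrite /l mevalB !mevalZ !mevalXU rmorphB !rmorphM.
exists h; split.
- rewrite -(subnK (ltnW he)); apply: dhomogM.
    exact: hXn.
  have cardj : #|[pred i | i != j]| = m by rewrite (cardC1 j) card_ord.
  rewrite -[X in (X * _)%N]cardj; apply: dhomog_prod_const => i _.
  by apply: rpredB; apply: hXn => //; apply: rpredB; apply: rpredZ.
- rewrite hE fmorph_eq0 mulf_neq0 ?expf_neq0 //; apply/prodf_neq0 => i _.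
  rewrite !expf_card_pred vj mulrC subrr eqxx subr0; exact: oner_neq0.
move=> u; rewrite hE fmorph_eq0 mulf_eq0 negb_or expf_eq0 subn_gt0 he /=.
case/andP=> uj /prodf_neq0 hu; exists (u 0 j / v 0 j).
  by rewrite mulf_neq0 ?invr_neq0.
apply/rowP=> i; rewrite mxE; have [->|/hu] := eqVneq i j.
  by rewrite divfK.
rewrite !expf_card_pred uj.
have [def_u _|] := eqVneq (v 0 j * u 0 i) (v 0 i * u 0 j).
  by apply: (mulfI vj); rewrite def_u mulrA [v 0 j * _]mulrC divfK // mulrC.
(* If the minor is nonzero, the factor is 1 - 1 = 0, against [hu]. *)
by rewrite -subr_eq0 => ->; rewrite subrr eqxx.
Qed.

End Separation.

Theorem theorem3p12 (q m : nat) (Fq : finFieldType) (k : closedFieldType)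
    (iota : {rmorphism Fq -> k}) (le : rel 'X_{1..m.+1})
    (r : nat) (F : r.-tuple {mpoly k[m.+1]})
    (hFq : #|Fq| = q)
    (hm : (0 < m)%N)
    (hk : forall x : k, algebraicOver iota x)
    (hle : monomial_order le)
    (hvar : forall i j : 'I_m.+1, (i < j)%N -> mo_lt le U_(j)%MM U_(i)%MM)
    (hF : forall i : 'I_r, tnth F i \is homog mdeg) :
  exists e0 : nat, forall e : nat, (e0 <= e)%N ->
    (#|` zeros_rat iota F| <= #|footprint q le F e|)%N.

Proof.
have q_gt0 : (0 < q)%N by rewrite -hFq; apply: ltnW; apply: card_finNzRing_gt1.
(* This is the least degree allowed by [point_separator]. *)
exists (m * (q - 1)).+1 => e he; set Z := zeros_rat iota F.
have repZ (P : Z) : exists v : {v : 'rV[Fq]_m.+1 | v != 0},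
    val P == proj_pt (exist _ (map_mx iota (val v)) (map_row_neq0 iota v)).
  have := valP P; rewrite !inE => /andP[/imfsetP[v _ def_P] _].
  by exists v; apply/eqP.
(* Representatives with coordinates in [Fq] are chosen because their images are fixed by the q-th
   power, as reduction requires; [proj_zeroP] carries the vanishing of F over to them. *)
pose v P := xchoose (repZ P).
have def_Z (P : Z) : val (val P) = <[map_mx iota (val (v P))]>%VS.
  by rewrite (eqP (xchooseP (repZ P))).
pose x P (i : 'I_m.+1) := iota (val (v P) 0 i).
pose A P (j : 'I_#|footprint q le F e|) :=
  ('X_[val (enum_val j)] : {mpoly k[m.+1]}).@[x P].
rewrite cardfE -[X in (_ <= X)%N]card_ord; apply: (card_le_separating (A := A)).
move=> w hw P0.
have xq P i : x P i ^+ q = x P i by rewrite -rmorphXn -hFq finfield.expf_card.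
have xF P f : f \in (F : seq _) -> f.@[x P] = 0.
  move=> fF; have := valP P; rewrite !inE => /andP[_ /allP/(_ _ fF)].
  have /tnthP[i def_f] := fF; have /homogP[d hf] := hF i.
  rewrite (proj_zeroP (v := map_mx iota (val (v P))) (d := d)) ?map_row_neq0 //.
  - by move=> /eqP <-; apply: meval_eq => i'; rewrite mxE.
  - by rewrite def_f.
  by rewrite def_Z memv_line.
have [|h [h_e hP0 hu]] := @point_separator Fq k iota m e _ (valP (v P0)).
  by rewrite hFq.
have L_foot mu : mu \in footprint q le F e ->
    \sum_P w P * ('X_[val mu] : {mpoly k[m.+1]}).@[x P] = 0.
  by move=> mu_f; have := hw (enum_rank_in mu_f mu); rewrite /A enum_rankK_in.
(* Applied to the separator h of P0, the relation collapses to w(P0) h(P0) = 0. *)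
have /eqP := footprint_functional q_gt0 hle hvar xq xF L_foot h_e.
rewrite (bigD1 P0) //= big1 => [|P neqP].
  by rewrite addr0 mulf_eq0 (negPf hP0) orbF => /eqP.
apply/eqP; rewrite mulf_eq0 orbC; apply/orP; left.
(* If h is nonzero at P, the representatives of P and P0 are proportional, so they span the same
   line. *)
apply: contraNT neqP => /hu[c c0 def_v]; apply/eqP/val_inj/val_inj.
rewrite !def_Z def_v map_mxZ; apply/eqP; rewrite eqEdim -memvE.
rewrite rpredZ ?memv_line //= !dim_vline map_row_neq0.
by rewrite scaler_eq0 fmorph_eq0 (negPf c0) map_row_neq0.
Qed.
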